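(* Let $a,b\in\mathbb{R}\setminus\{0\}$ and let $$W(x)=e^{-x^{2}}\begin{pmatrix} e^{2bx}+a^{2}x^{2} & ax\\ ax & 1\end{pmatrix},\quad x\in\mathbb{R}.$$ Then the right Fourier algebra of $W$ is $$\mathcal F_R(W)=\left\{\sum_{j=0}^{n}\left(\partial^{j}\begin{pmatrix}p_j(x)& ax\,(q_j(x)-p_j(x))\\0&q_j(x)\end{pmatrix}+\partial^{j-1}\begin{pmatrix}0&j\,a\,q_j(x)\\0&0\end{pmatrix}\right)\ :\ p_j,q_j\in\mathbb{C}[x],\ n\ge0\right\},$$ where for $j=0$ the second term (with coefficient $j=0$) is zero.
   Context: Differential operators $\mathfrak D=\sum_{j=0}^s\partial^jF_j(x)$, $\partial=\frac{d}{dx}$, with $F_j\in\operatorname{Mat}_2(\mathbb{C}[x])$, act on the right on $2\times2$ matrix-valued functions by $P\cdot\mathfrak D=\sum_jP^{(j)}(x)F_j(x)$; $\operatorname{Mat}_2(\Omega[x])$ denotes the algebra of these, with product given by $P\cdot(\mathfrak D_1\mathfrak D_2)=(P\cdot\mathfrak D_1)\cdot\mathfrak D_2$. Let $P(x,n)$, $n\in\mathbb{N}_0$, be the monic orthogonal polynomials in $\operatorname{Mat}_2(\mathbb{C}[x])$ for $\langle P,Q\rangle=\int_{\mathbb{R}}P(x)W(x)Q(x)^*dx$. Discrete operators $\mathscr M=\sum_{j=-\ell}^kA_j(n)\delta^j$, with $A_j(n)\in\operatorname{Mat}_2(\mathbb{C})$ for each $n$, act on the left by $(\mathscr M\cdot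 P)(x,n)=\sum_{j=-\ell}^kA_j(n)P(x,n+j)$, with $P(x,m)=0$ for $m<0$. The right Fourier algebra is $$\mathcal F_R(W)=\{\mathfrak D\in\operatorname{Mat}_2(\Omega[x]):\ \exists\text{ a discrete operator }\mathscr M\text{ with }P(x,n)\cdot\mathfrak D=\mathscr M\cdot P(x,n)\ \text{for all }n\}.$$ By a theorem of Casper and Yakimov, for a weight matrix $V$ of size $2$, $\mathcal F_R(V)$ is the set of $\mathfrak D\in\operatorname{Mat}_2(\Omega[x])$ that are $V$-adjointable (i.e. there is $\widetilde{\mathfrak D}\in\operatorname{Mat}_2(\Omega[x])$ with $\langle P\mathfrak D,Q\rangle_V=\langle P,Q\widetilde{\mathfrak D}\rangle_V$ for all matrix polynomials $P,Q$) and whose formal $V$-adjoint $\mathfrak D^\dagger=V(x)\mathfrak D^*V(x)^{-1}$ has polynomial coefficients, where ${}^*$ is the involution extending conjugate transposition on matrix polynomials and sending $\partial I$ to $-\partial I$. *)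

(* Defs.v *)
From HB Require Import structures.
From mathcomp Require Import all_boot all_order all_algebra.
From mathcomp Require Import complex.
From mathcomp Require Import all_classical all_reals all_analysis.

Set Implicit Arguments.
Unset Strict Implicit.
Unset Printing Implicit Defensive.

Import Order.TTheory GRing.Theory Num.Theory.
Import numFieldNormedType.Exports.

Local Open Scope ring_scope.
Local Open Scope complex_scope.
Local Open Scope classical_set_scope.

Definition mat2 (T : Type) (u v w z : T) : 'M[T]_2 :=
  \matrix_(i, j) if i == ord0 then (if j == ord0 then u else v)
                 else (if j == ord0 then w else z).

(* The complex numbers are R[i], and Mat_2(C[x]) is 'M[{poly R[i]}]_2. *)

Definition evalmx (R : realType) (P : 'M[{poly R[i]}]_2) (x : R) : 'M[R[i]]_2 :=
  map_mx (fun p : {poly R[i]} => p.[x%:C]) P.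

Definition coefmx (R : realType) (P : 'M[{poly R[i]}]_2) (k : nat) :
    'M[R[i]]_2 :=
  map_mx (fun p : {poly R[i]} => p`_k) P.

Definition derivnmx (R : realType) (j : nat) (P : 'M[{poly R[i]}]_2) :
    'M[{poly R[i]}]_2 :=
  map_mx (fun p : {poly R[i]} => derivn j p) P.

Definition adjmx (R : realType) (A : 'M[R[i]]_2) : 'M[R[i]]_2 :=
  (map_mx (@conjc R) A)^T.

Definition cintegral (R : realType) (f : R -> R[i]) : R[i] :=
  (\int[@lebesgue_measure R]_x complex.Re (f x))
  +i* (\int[@lebesgue_measure R]_x complex.Im (f x)).

Definition mxinner (R : realType) (W : R -> 'M[R[i]]_2)
    (P Q : 'M[{poly R[i]}]_2) : 'M[R[i]]_2 :=
  \matrix_(i, j)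
    cintegral (fun x => (evalmx P x *m W x *m adjmx (evalmx Q x)) i j).

Definition monic_of_degree (R : realType) (n : nat) (P : 'M[{poly R[i]}]_2) :
    Prop :=
  coefmx P n = 1%:M /\ (forall k, (n < k)%N -> coefmx P k = 0).

Definition monic_orthogonal (R : realType) (W : R -> 'M[R[i]]_2)
    (P : nat -> 'M[{poly R[i]}]_2) : Prop :=
  (forall n, monic_of_degree n (P n)) /\
  (forall m n, m <> n -> mxinner W (P m) (P n) = 0).

(* The operator sum_j d^j F_j is stored as the polynomial sum_j F_j 'X^j, so
   that 'X^j stands for d^j and two operators are equal iff their coefficients
   F_j are.  Only the additive structure of {poly _} is meaningful here: the
   product of {poly _} is not the composition of operators. *)
Definition diffop (R : realType) : Type := {poly 'M[{poly R[i]}]_2}.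

Definition diffop_act (R : realType) (P : 'M[{poly R[i]}]_2) (D : diffop R) :
    'M[{poly R[i]}]_2 :=
  \sum_(j < size D) derivnmx j P *m D`_j.

Definition diffterm (R : realType) (j : nat) (F : 'M[{poly R[i]}]_2) :
    diffop R := F *: 'X^j.

(* sum_(j = - discop_lo)^discop_hi A_j(n) delta^j, with discop_coef j n = A_j(n) *)
Record discop (R : realType) : Type := Discop {
  discop_lo : nat;
  discop_hi : nat;
  discop_coef : int -> nat -> 'M[R[i]]_2 }.

Definition extend0 (R : realType) (P : nat -> 'M[{poly R[i]}]_2) (m : int) :
    'M[{poly R[i]}]_2 :=
  if m is Posz k then P k else 0.

(* The summation index i corresponds to j = i - discop_lo. *)
Definition discop_act (R : realType) (M : discop R)
    (P : nat -> 'M[{poly R[i]}]_2) (n : nat) : 'M[{poly R[i]}]_2 :=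
  \sum_(i < (discop_lo M + discop_hi M).+1)
    map_mx polyC (discop_coef M (i%:Z - (discop_lo M)%:Z) n)
    *m extend0 P (n%:Z + (i%:Z - (discop_lo M)%:Z)).

(* P is uniquely determined by W. *)
Definition right_fourier_algebra (R : realType) (W : R -> 'M[R[i]]_2) :
    set (diffop R) :=
  [set D | exists P, monic_orthogonal W P /\
     exists M : discop R, forall n, diffop_act (P n) D = discop_act M P n].

Definition weight (R : realType) (a b x : R) : 'M[R[i]]_2 :=
  (expR (- x ^+ 2))%:C *:
    mat2 (expR (2 * b * x) + a ^+ 2 * x ^+ 2)%:C (a * x)%:C
         (a * x)%:C                              1.

(* Main.v *)
(* Write W = T diag(w_b, w_0) T^* with w_c(x) = exp(- x^2 + 2 c x) and
   T = [[1, a x], [0, 1]].  The operators of the theorem are exactly the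
   T diag(E_1, E_2) T^-1 with E_1, E_2 scalar differential operators.
   An operator D satisfies P_n D = M P_n for a band operator M iff the map
   P |-> P D has an adjoint on matrix polynomials whose degree increase is
   bounded.  Integration by parts gives such an adjoint for every scalar
   operator with respect to every w_c, hence for T diag(E_1, E_2) T^-1.
   Conversely, an off-diagonal entry E of T^-1 D T would satisfy
   int (r E) s w_c = int r t w_d for all polynomials r, with c <> d; this forces
   both sides to vanish because exp(2 (d - c) x) is not a rational function. *)

Require Import Defs.
From HB Require Import structures.
From mathcomp Require Import all_boot all_order all_algebra.
From mathcomp Require Import complex.
From mathcomp Require Import all_classical all_reals all_analysis.
From mathcomp Require Import measurable_realfun ring lra zify.

Set Implicit Arguments.
Unset Strict Implicit.
Unset Printing Implicit Defensive.

Import Order.TTheory GRing.Theory Num.Theory.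
Import numFieldNormedType.Exports.

Local Open Scope ring_scope.
Local Open Scope complex_scope.
Local Open Scope classical_set_scope.

(** * Scalar Gaussian weights and integrals of real polynomials against them *)

Definition wt (R : realType) (c x : R) : R := expR (- x ^+ 2 + 2 * c * x).

Section Gaussian.
Variable R : realType.
Implicit Types (c x : R) (p q : {poly R}).
Local Notation mu := (@lebesgue_measure R).

Lemma wt_gt0 c x : 0 < wt c x. Proof. exact: expR_gt0. Qed.

Lemma exprn_le_expR k x : `|x| ^+ k <= k`!%:R * expR `|x|.
Proof.
case: k => [|k]; first by rewrite fact0 mul1r expr0 -expR0 ler_expR.
rewrite mulrC -ler_pdivrMr ?ltr0n ?fact_gt0//.
by apply: le_trans (expR_ge1Dxn k (normr_ge0 x)); rewrite lerDr ler01.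
Qed.

(** Domination by the standard normal density reduces integrability and decay to known facts. With
    [|x| ^+ k] bounded by [k!] times [expR |x|], what remains is [d |x| - x^2 <= d^2 / 2 - x^2 / 2],
    a completed square. *)
Lemma monomial_wt_bound c k : exists2 K : R, 0 <= K &
  forall x, `|x ^+ k * wt c x| <= K * normal_pdf 0 1 x.
Proof.
(* [d] collects the linear growth in the exponent: [1] from [expR |x|] and [2 |c|] from the
   weight. *)
pose d := 1 + 2 * `|c|.
pose s := normal_peak (1 : R).
have s0 : 0 < s by exact: normal_peak_gt0.
exists (k`!%:R * expR (d ^+ 2 / 2) / s).
  by rewrite !mulr_ge0 ?invr_ge0 ?expR_ge0// ltW.
move=> x; rewrite normal_pdfE// /normal_fun -/s.
rewrite mulrA divfK ?gt_eqF// -mulrA -expRD normrM normrX (ger0_norm (ltW (wt_gt0 _ _))).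
apply: (le_trans (ler_wpM2r (ltW (wt_gt0 _ _)) (exprn_le_expR k x))).
rewrite -mulrA ler_wpM2l// -expRD ler_expR subr0 expr1n.
have -> : - x ^+ 2 / (1 *+ 2) = - x ^+ 2 / 2 by [].
have h1 : c * x <= `|c| * `|x| by rewrite -normrM ler_norm.
have h2 : x ^+ 2 = `|x| ^+ 2 by rewrite real_normK// num_real.
have h3 : 0 <= (`|x| - d) ^+ 2 by rewrite sqr_ge0.
move: h3; rewrite h2 /d; move: h1; set u := `|x|; set v := `|c|; set w := c * x.
have -> : 2 * c * x = 2 * w by rewrite /w; ring.
nra.
Qed.

Lemma continuous_wt c : continuous (wt c).
Proof.
move=> x; apply: (@continuous_comp _ _ _ (fun x : R => - x ^+ 2 + 2 * c * x) expR);
  last exact: continuous_expR.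
apply: cvgD; first by apply: cvgN; exact: exprn_continuous.
by apply: cvgM; [exact: cvg_cst|exact: cvg_id].
Qed.

Lemma continuous_poly_wt c p : continuous (fun x => p.[x] * wt c x).
Proof.
by move=> x; apply: cvgM; [exact: continuous_horner|exact: continuous_wt].
Qed.

Lemma measurable_poly_wt c p : measurable_fun setT (fun x => p.[x] * wt c x).
Proof. by apply: continuous_measurable_fun; exact: continuous_poly_wt. Qed.

Lemma poly_wt_bound c p : exists2 K : R, 0 <= K &
  forall x, `|p.[x] * wt c x| <= K * normal_pdf 0 1 x.
Proof.
have /choice[K HK] : forall k, exists K : R, 0 <= K /\
    forall x, `|x ^+ k * wt c x| <= K * normal_pdf 0 1 x.
  by move=> k; have [K K0 HK] := monomial_wt_bound c k; exists K.
exists (\sum_(i < size p) `|p`_i| * K i).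
  by apply: sumr_ge0 => i _; rewrite mulr_ge0//; have [] := HK i.
move=> x; rewrite horner_coef mulr_suml mulr_suml.
apply: le_trans (ler_norm_sum _ _ _) _; apply: ler_sum => i _.
by rewrite -mulrA normrM -mulrA ler_wpM2l//; have [_] := HK i.
Qed.

Lemma integrable_poly_wt c p :
  mu.-integrable setT (EFin \o (fun x => p.[x] * wt c x)).
Proof.
have [K K0 HK] := poly_wt_bound c p.
have : mu.-integrable setT (fun x => (K%:E * (normal_pdf 0 1 x)%:E)%E).
  by apply: integrableZl => //; exact: integrable_normal_pdf.
apply: le_integrable => //.
- by apply/measurable_EFinP; exact: measurable_poly_wt.
- move=> x _ /=; rewrite lee_fin (ger0_norm (_ : 0 <= K * _))//.
  by rewrite mulr_ge0// normal_pdf_ge0.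
Qed.

Definition gint c p : R := \int[mu]_x (p.[x] * wt c x).

(** Dominated convergence for truncations, the integrable function itself being the dominating one.
    Using [n.+1] keeps every interval nondegenerate, as the fundamental theorem of calculus requires
    below. *)
Lemma cvg_integral_poly_wt c p :
  (\int[mu]_(x in `[(- n.+1%:R)%R, (n.+1%:R)%R]) (p.[x] * wt c x)%:E)%E @[n --> \oo]
    --> (\int[mu]_x (p.[x] * wt c x)%:E)%E.
Proof.
pose f := EFin \o (fun x => p.[x] * wt c x).
pose I n : set R := `[- n.+1%:R, n.+1%:R].
have mf : measurable_fun setT f by apply/measurable_EFinP; exact: measurable_poly_wt.
have [] := @dominated_convergence _ _ R mu setT measurableT (fun n => f \_ (I n))
   f (fun x => `|f x|%E).
- move=> n; have mI : measurable (I n) by rewrite /I; exact: measurable_itv.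
  have mfI : measurable_fun (I n) f by exact: (measurable_funS measurableT (@subsetT _ _) mf).
  by apply: (iffLR (measurable_restrictT f mI)).
- exact: mf.
- apply: aeW => x _; apply: cvg_near_cst.
  near=> n; rewrite patchE mem_set// /I /= in_itv/= -ler_norml.
  have xn : `|x| <= n%:R by near: n; exact: nbhs_infty_ger.
  by rewrite (le_trans xn)// ler_nat.
- by apply: integrable_abse; exact: integrable_poly_wt.
- by apply: aeW => x n _; rewrite patchE; case: ifPn => // _; rewrite abse0.
move=> _ _; apply: cvg_trans; apply: near_eq_cvg.
by near=> n; rewrite integral_mkcond.
Unshelve. all: by end_near.
Qed.

(** Bounding ['X * p] instead of [p] gains a factor [1 / n.+1]. The sign [s] selects the end of the
    line. *)
Lemma cvg_poly_wt_at_infinity c p (s : R) : `|s| = 1 ->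
  p.[s * n.+1%:R] * wt c (s * n.+1%:R) @[n --> \oo] --> (0 : R).
Proof.
move=> s1; have [K K0 HK] := poly_wt_bound c ('X * p).
apply/norm_cvg0P; pose B := K * normal_peak 1.
apply: (@squeeze_cvgr _ _ _ _ (cst 0) (fun n => B * harmonic n)).
- near=> n; rewrite normr_ge0/= /B /= ler_pdivlMr ?ltr0n//.
  apply: le_trans (le_trans (HK (s * n.+1%:R)) _).
    by rewrite hornerM hornerX !normrM s1 mul1r normr_nat mulrC mulrA.
  by rewrite ler_wpM2l// normal_pdf_ub.
- exact: cvg_cst.
- by rewrite -(mulr0 B); apply: cvgM; [exact: cvg_cst|exact: cvg_harmonic].
Unshelve. all: by end_near.
Qed.

(** The polynomial factor of the derivative of [p * wt c], since [wt c] has logarithmic derivative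
    [- 2 (x - c)]. *)
Definition poly_wt_deriv c p : {poly R} := p^`() - (2 *: ('X - c%:P)) * p.

Lemma is_derive_poly_wt c p x :
  is_derive x 1 (fun x => p.[x] * wt c x) ((poly_wt_deriv c p).[x] * wt c x).
Proof.
pose e : {poly R} := - 'X ^+ 2 + (2 * c) *: 'X.
have -> : (fun x => p.[x] * wt c x) = horner p * (expR \o horner e).
  apply/funext => y; rewrite /wt /e; congr (_ * expR _).
  by rewrite /= !hornerE.
have de : is_derive x 1 (expR \o horner e) (expR e.[x] * e^`().[x]).
  exact: is_derive1_comp.
apply: (@is_derive_eq _ _ _ _ _ _ _ _ (is_deriveM _ de)).
rewrite /GRing.scale /= /poly_wt_deriv /e /wt !(hornerE, poly.derivE) /=.
ring.
Qed.

(** The integrand is a total derivative: on each truncated interval the integral is a difference of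
    boundary values, and these tend to 0. *)
Lemma gint_deriv c p : gint c (poly_wt_deriv c p) = 0.
Proof.
set q := poly_wt_deriv c p; pose F x := p.[x] * wt c x.
rewrite /gint /Rintegral; suff -> : (\int[mu]_x (q.[x] * wt c x)%:E = 0%:E)%E by [].
apply: (cvg_unique (@ereal_hausdorff _) (@cvg_integral_poly_wt c q)).
apply: (@cvg_trans _ ((F n.+1%:R - F (- n.+1%:R))%:E @[n --> \oo])).
  apply: near_eq_cvg; near=> n.
  rewrite (@continuous_FTC2 _ _ F)//.
  - by rewrite gtrN.
  - by apply: continuous_subspaceT; exact: continuous_poly_wt.
  - split.
    + by move=> x _; apply: ex_derive; exact: is_derive_poly_wt.
    + by apply: cvg_at_right_filter; exact: continuous_poly_wt.
    + by apply: cvg_at_left_filter; exact: continuous_poly_wt.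
  - by move=> x _; rewrite derive1E; apply: derive_val; exact: is_derive_poly_wt.
apply: cvg_EFin; first by near=> n.
rewrite -(subr0 0); apply: cvgB.
  have := @cvg_poly_wt_at_infinity c p 1 (normr1 _).
  by under eq_fun do rewrite mul1r.
have := @cvg_poly_wt_at_infinity c p (-1) (normrN1 _).
by under eq_fun do rewrite mulN1r.
Unshelve. all: by end_near.
Qed.

Lemma gintD c p q : gint c (p + q) = gint c p + gint c q.
Proof.
rewrite /gint -RintegralD//; try exact: integrable_poly_wt.
by apply: eq_Rintegral => x _; rewrite hornerD mulrDl.
Qed.

Lemma gintZ c (k : R) p : gint c (k *: p) = k * gint c p.
Proof.
rewrite /gint -RintegralZl//; last exact: integrable_poly_wt.
by apply: eq_Rintegral => x _; rewrite hornerZ mulrA.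
Qed.

Lemma gint_ge0 c p : (forall x, 0 <= p.[x]) -> 0 <= gint c p.
Proof. by move=> p0; apply: Rintegral_ge0 => x _; rewrite mulr_ge0// ltW// wt_gt0. Qed.

(** A nonnegative integrand with zero integral vanishes almost everywhere, whereas a nonzero
    polynomial has only finitely many roots. *)
Lemma gint_eq0 c p : (forall x, 0 <= p.[x]) -> gint c p = 0 -> p = 0.
Proof.
move=> p0 /eqP; rewrite /gint /Rintegral fine_eq0; last first.
  exact: (integrable_fin_num _ (integrable_poly_wt c p)).
move=> /eqP int0; apply: contrapT => /eqP pN0.
have mf : measurable_fun (setT : set (measurableTypeR R))
    (EFin \o (fun x => p.[x] * wt c x)).
  by apply/measurable_EFinP; exact: measurable_poly_wt.
have /(ae_eq_integral_abs mu measurableT mf).1 ae0 :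
    (\int[mu]_x `|(p.[x] * wt c x)%R%:E| = 0)%E.
  rewrite -int0; apply: eq_integral => x _ /=.
  by rewrite ger0_norm// mulr_ge0// ltW// wt_gt0.
have root_fin : finite_set [set x | root p x].
  apply: contrapT => /(infinite_set_fset (size p))[B Bp].
  rewrite leqNgt => /negP; apply; apply: max_poly_roots => //.
    by apply/allP => x xB; apply: Bp.
  exact: finmap.fset_uniq.
have root0 : mu.-negligible ([set x | root p x] : set (measurableTypeR R)).
  apply/negligibleP.
    by apply: countable_measurable;
      [exact: measurable_set1|exact: (finite_set_countable root_fin)].
  exact: (countable_lebesgue_measure0 (finite_set_countable root_fin)).
(* The exceptional null set and the root set together cover the unit interval, whose measure is
   1. *)
have : mu.-negligible (`[0, 1] : set (measurableTypeR R)).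
  apply: negligibleS (negligibleU ae0 root0) => x _ /=.
  have [r|r] := boolP (root p x); first by right.
  left => /(_ I)[] /eqP; rewrite mulf_eq0 (gt_eqF (wt_gt0 c x)) orbF.
  by apply/negP.
move/negligibleP => /(_ (measurable_itv _)).
have := @lebesgue_measure_itv R (Interval (BLeft 0) (BRight 1)).
rewrite /= lte_fin ltr01 sube0 => -> /eqP.
by rewrite eqe oner_eq0.
Qed.

End Gaussian.

(** * Integrals of complex polynomials and independence of two Gaussian weights *)

Section ComplexGaussian.
Variable R : realType.
Implicit Types (c d : R) (p q : {poly R[i]}).
Local Notation mu := (@lebesgue_measure R).

Definition polyRe p : {poly R} := map_poly (@complex.Re R) p.
Definition polyIm p : {poly R} := map_poly (@complex.Im R) p.
(** Conjugating coefficients agrees with conjugating values at real points. *)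
Definition pconj p : {poly R[i]} := map_poly (@conjc R) p.

Lemma coef_polyRe p i : (polyRe p)`_i = complex.Re p`_i.
Proof. by rewrite coef_map_id0. Qed.

Lemma coef_polyIm p i : (polyIm p)`_i = complex.Im p`_i.
Proof. by rewrite coef_map_id0. Qed.

Lemma ReD (z w : R[i]) : complex.Re (z + w) = complex.Re z + complex.Re w.
Proof. by case: z w => [? ?] []. Qed.

Lemma ImD (z w : R[i]) : complex.Im (z + w) = complex.Im z + complex.Im w.
Proof. by case: z w => [? ?] []. Qed.

Lemma horner_polyRe p x : (polyRe p).[x] = complex.Re p.[x%:C].
Proof.
elim/poly_ind: p => [|p z IH].
  by rewrite /polyRe map_poly0 !horner0.
have -> : polyRe (p * 'X + z%:P) = polyRe p * 'X + (complex.Re z)%:P.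
  apply/polyP => i; rewrite coef_polyRe !coefD !coefMX !coefC ReD.
  by case: i => [|i] /=; rewrite ?coef_polyRe.
rewrite !hornerE IH ReD; congr (_ + _).
by case: p.[_] => u v /=; rewrite mulr0 subr0.
Qed.

Lemma horner_polyIm p x : (polyIm p).[x] = complex.Im p.[x%:C].
Proof.
elim/poly_ind: p => [|p z IH].
  by rewrite /polyIm map_poly0 !horner0.
have -> : polyIm (p * 'X + z%:P) = polyIm p * 'X + (complex.Im z)%:P.
  apply/polyP => i; rewrite coef_polyIm !coefD !coefMX !coefC ImD.
  by case: i => [|i] /=; rewrite ?coef_polyIm.
rewrite !hornerE IH ImD; congr (_ + _).
by case: p.[_] => u v /=; rewrite mulr0 add0r.
Qed.

(** The integral of [p] against [wt c] over the real line, as a linear functional on complex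
    polynomials. *)
Definition cgint c p : R[i] := gint c (polyRe p) +i* gint c (polyIm p).

Lemma cgint_is_linear c : linear_for *%R (cgint c).
Proof.
move=> [u v] p q; rewrite /cgint.
have -> : polyRe ((u +i* v) *: p + q) = u *: polyRe p + (- v) *: polyIm p + polyRe q.
  apply/polyP => i; rewrite !(coefD, coefZ, coef_polyRe, coef_polyIm) ReD.
  by case: p`_i => a b /=; rewrite mulNr.
have -> : polyIm ((u +i* v) *: p + q) = u *: polyIm p + v *: polyRe p + polyIm q.
  apply/polyP => i; rewrite !(coefD, coefZ, coef_polyRe, coef_polyIm) ImD.
  by case: p`_i => a b /=.
by rewrite !gintD !gintZ; simpc.
Qed.

HB.instance Definition _ c :=
  GRing.isLinear.Build R[i] {poly R[i]} R[i] *%R (cgint c) (@cgint_is_linear c).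

Lemma cgintZ c (k : R[i]) p : cgint c (k *: p) = k * cgint c p.
Proof. exact: linearZ. Qed.

Lemma cgintD c p q : cgint c (p + q) = cgint c p + cgint c q.
Proof. exact: raddfD. Qed.

Lemma cgint_real c (A : {poly R}) :
  cgint c (map_poly (real_complex R) A) = (gint c A)%:C.
Proof.
rewrite /cgint (_ : polyRe _ = A); last first.
  by apply/polyP => i; rewrite coef_polyRe coef_map.
rewrite (_ : polyIm _ = 0 *: A) ?gintZ ?mul0r//.
by apply/polyP => i; rewrite coef_polyIm coef_map coefZ mul0r.
Qed.

Lemma cgint_deriv c p : cgint c p^`() = cgint c (2 *: ('X - c%:C%:P) * p).
Proof.
have dreal (A : {poly R}) : cgint c (map_poly (real_complex R) A)^`() =
    cgint c (2 *: ('X - c%:C%:P) * map_poly (real_complex R) A).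
  apply/eqP; rewrite -subr_eq0 -linearB /= deriv_map.
  have -> : 2 *: ('X - c%:C%:P) = map_poly (real_complex R) (2 *: ('X - c%:P)).
    by rewrite map_polyZ rmorphB /= map_polyX map_polyC /= rmorph_nat.
  by rewrite -rmorphM -rmorphB cgint_real gint_deriv.
have -> : p = map_poly (real_complex R) (polyRe p) +
              (0 +i* 1) *: map_poly (real_complex R) (polyIm p).
  apply/polyP => i; rewrite coefD coefZ !coef_map_id0 ?coef_map_id0 //.
  by rewrite [LHS]complexE.
by rewrite derivD derivZ mulrDr -scalerAr !cgintD !cgintZ !dreal.
Qed.

(** The shape in which each entry of the matrix inner product occurs, with one term for each
    diagonal weight. *)
Lemma cintegral_poly_wt c d p q :
  cintegral (fun x => p.[x%:C] * (wt c x)%:C + q.[x%:C] * (wt d x)%:C) =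
  cgint c p + cgint d q.
Proof.
have e f (z : R[i]) : complex.Re (z * f%:C) = complex.Re z * f.
  by case: z => ? ? /=; rewrite mulr0 subr0.
have e' f (z : R[i]) : complex.Im (z * f%:C) = complex.Im z * f.
  by case: z => ? ? /=; rewrite mulr0 add0r.
rewrite /cintegral /cgint /gint.
under eq_Rintegral do rewrite ReD !e -!horner_polyRe.
under [X in _ +i* X]eq_Rintegral do rewrite ImD !e' -!horner_polyIm.
by rewrite !RintegralD//; try exact: integrable_poly_wt.
Qed.

Lemma pconjK p : pconj (pconj p) = p.
Proof.
by apply/polyP => i; rewrite /pconj !coef_map /= conjcK.
Qed.

Lemma cgint_conj c p : cgint c (pconj p) = conjc (cgint c p).
Proof.
rewrite /cgint; have -> : polyRe (pconj p) = polyRe p.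
  by apply/polyP => i; rewrite !coef_polyRe coef_map /=; case: p`_i.
have -> : polyIm (pconj p) = (-1) *: polyIm p.
  apply/polyP => i; rewrite coefZ !coef_polyIm coef_map /=; case: p`_i => ? ? /=.
  by rewrite mulN1r.
by rewrite gintZ mulN1r.
Qed.

(** The product is fixed by [pconj], so its coefficients are real. *)
Lemma polyIm_sqr p : polyIm (p * pconj p) = 0.
Proof.
apply/polyP => i; rewrite coef_polyIm coef0.
have : pconj (p * pconj p) = p * pconj p.
  by rewrite /pconj rmorphM /= -!/(pconj _) pconjK mulrC.
move/(congr1 (fun q : {poly R[i]} => q`_i)); rewrite coef_map /=.
case: (_`_i) => u v /= [] /eqP; rewrite eqNr => /eqP->; by [].
Qed.

Lemma polyRe_sqr_ge0 p x : 0 <= (polyRe (p * pconj p)).[x].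
Proof.
rewrite horner_polyRe hornerM -[X in (pconj p).[X]]conjc_real horner_map /=.
by have := mulcJ_ge0 p.[x%:C]; rewrite lecE => /andP[].
Qed.

Lemma cgint_sqr_ge0 c p : 0 <= cgint c (p * pconj p).
Proof.
have g0 : gint c 0 = 0 by rewrite -(scale0r 0) gintZ mul0r.
rewrite /cgint polyIm_sqr g0 lecE /= eqxx /=.
by apply: gint_ge0 => x; exact: polyRe_sqr_ge0.
Qed.

Lemma cgint_sqr_eq0 c p : cgint c (p * pconj p) = 0 -> p = 0.
Proof.
move=> -[] /(gint_eq0 (polyRe_sqr_ge0 p)) e _.
have : p * pconj p = 0.
  apply/polyP => i; move/polyP/(_ i): e; have /polyP/(_ i) := polyIm_sqr p.
  rewrite coef_polyIm coef_polyRe !coef0.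
  by case: (_`_i) => u v /= -> ->.
move/eqP; rewrite mulf_eq0 => /orP[/eqP//|/eqP e0].
by rewrite -(pconjK p) e0 /pconj map_poly0.
Qed.

(** Differentiation lowers the degree, so the leading coefficient of the sum is [k] times that of
    [p]. *)
Lemma deriv_scale_eq0 (k : R[i]) p : k != 0 -> p^`() + k *: p = 0 -> p = 0.
Proof.
move=> k0 /polyP/(_ (size p).-1); rewrite coefD coef_deriv coefZ coef0.
have [->//|p0] := eqVneq p 0.
rewrite prednK ?size_poly_gt0// nth_default// mul0rn add0r => /eqP.
by rewrite mulf_eq0 (negPf k0) /= -lead_coefE lead_coef_eq0 (negPf p0).
Qed.

(* The operator [p |-> 2 (X - c) p - p'] is the transpose of [f |-> f'] for
   [cgint c] and of [f |-> f' + 2 (d - c) f] for [cgint d]: iterating it kills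
   [al], but never [be]. *)
Lemma cgint_indep c d al be : c != d ->
  (forall p, cgint c (p * al) + cgint d (p * be) = 0) -> be = 0.
Proof.
move=> cd; have [n] := ubnP (size al); elim: n al be => // n IH al be sz H.
have [a0|a0] := eqVneq al 0.
  apply: (@cgint_sqr_eq0 d).
  (* Testing on the conjugate of [be] turns the remaining integral into its squared norm. *)
  by have := H (pconj be); rewrite a0 mulr0 linear0 add0r mulrC.
pose k : R[i] := 2 * (d%:C - c%:C).
have k0 : k != 0 by rewrite mulf_neq0 ?pnatr_eq0// subr_eq0 eq_sym (inj_eq (@complexI _)).
apply: (deriv_scale_eq0 k0); apply: (IH (deriv al)).
  by rewrite -ltnS; apply: leq_trans sz; rewrite ltnS; exact: lt_size_deriv.
move=> p; have := H (2 *: ('X - c%:C%:P) * p - p^`()).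
have split e f : cgint e ((2 *: ('X - c%:C%:P) * p - p^`()) * f) =
    cgint e (p * (f^`() + (2 * (e%:C - c%:C)) *: f)).
  have -> : (2 *: ('X - c%:C%:P) * p - p^`()) * f =
     2 *: ('X - e%:C%:P) * (p * f) - (p * f)^`() + 
      p * (f^`() + (2 * (e%:C - c%:C)) *: f).
    rewrite derivM -!mul_polyC polyCM polyCB; ring.
  by rewrite linearD linearB /= cgint_deriv subrr add0r.
by rewrite !split subrr mulr0 scale0r addr0.
Qed.

End ComplexGaussian.

(** * Degrees of matrix polynomials and expansions in monic families *)

Section MatrixPolynomials.
Variable R : realType.
Implicit Types (A : 'M[R[i]]_2) (P Q : 'M[{poly R[i]}]_2).

Definition cmx A : 'M[{poly R[i]}]_2 := map_mx polyC A.

Definition degree_lt n P := forall k, (n <= k)%N -> coefmx P k = 0.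

Lemma coefmxD P Q k : coefmx (P + Q) k = coefmx P k + coefmx Q k.
Proof. by apply/matrixP => i j; rewrite !mxE coefD. Qed.

Lemma coefmxN P k : coefmx (- P) k = - coefmx P k.
Proof. by apply/matrixP => i j; rewrite !mxE coefN. Qed.

Lemma coefmx_cmul A P k : coefmx (cmx A *m P) k = A *m coefmx P k.
Proof.
apply/matrixP => i j; rewrite !mxE coef_sum; apply: eq_bigr => l _.
by rewrite !mxE coefCM.
Qed.

Lemma degree_ltP n P : degree_lt n P <-> forall i j, (size (P i j) <= n)%N.
Proof.
split=> [H i j|H k nk].
  by apply/leq_sizeP => k nk; have /matrixP/(_ i j) := H k nk; rewrite !mxE.
by apply/matrixP => i j; rewrite !mxE nth_default// (leq_trans (H i j)).
Qed.

Lemma degree_ltW m n P : (m <= n)%N -> degree_lt m P -> degree_lt n P.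
Proof. by move=> mn H k nk; apply: H; exact: leq_trans nk. Qed.

Lemma degree_lt_exists P : exists n, degree_lt n P.
Proof.
exists (\max_i \max_j size (P i j))%N; apply/degree_ltP => i j.
apply: leq_trans (leq_bigmax i); exact: (leq_bigmax (F := fun j => size (P i j))).
Qed.

Lemma degree_lt0 P : degree_lt 0 P -> P = 0.
Proof.
move/degree_ltP => H; apply/matrixP => i j; rewrite mxE; apply/eqP.
by rewrite -size_poly_leq0.
Qed.

Lemma degree_lt_sum n (I : Type) (s : seq I) (F : I -> 'M[{poly R[i]}]_2) :
  (forall i, degree_lt n (F i)) -> degree_lt n (\sum_(i <- s) F i).
Proof.
move=> H k nk; elim/big_ind: _ => [|U V hU hV|i _]; last exact: H.
  by apply/matrixP => i j; rewrite !mxE coef0.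
by rewrite coefmxD hU hV addr0.
Qed.

Lemma monic_degree_lt n P : monic_of_degree n P -> degree_lt n.+1 P.
Proof. by move=> [_ H] k; exact: H. Qed.

Lemma adjmxK A : adjmx (adjmx A) = A.
Proof. by apply/matrixP => i j; rewrite !mxE conjcK. Qed.

Lemma adjmx0 : adjmx 0 = 0 :> 'M[R[i]]_2.
Proof. by apply/matrixP => i j; rewrite !mxE conjc0. Qed.

Lemma adjmxD A A' : adjmx (A + A') = adjmx A + adjmx A'.
Proof. by apply/matrixP => i j; rewrite !mxE rmorphD. Qed.

Lemma adjmxM A A' : adjmx (A *m A') = adjmx A' *m adjmx A.
Proof. by rewrite /adjmx map_mxM trmx_mul. Qed.

Lemma cmx_monic n P A : monic_of_degree n P -> cmx A *m P = 0 -> A = 0.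
Proof.
move=> [Pn _] /(congr1 (fun Q => coefmx Q n)); rewrite coefmx_cmul Pn mulmx1 => ->.
by apply/matrixP => i j; rewrite !mxE coef0.
Qed.

(** Division by leading terms: subtracting the coefficient of degree [N] times [P N] lowers the
    degree, because [P N] is monic. *)
Lemma monic_expansion (P : nat -> 'M[{poly R[i]}]_2) N Q :
  (forall n, (n < N)%N -> monic_of_degree n (P n)) -> degree_lt N Q ->
  exists C : nat -> 'M[R[i]]_2, Q = \sum_(m < N) cmx (C m) *m P m.
Proof.
elim: N Q => [|N IH] Q mP dQ.
  by exists (fun=> 0); rewrite big_ord0; exact: degree_lt0.
have [mN1 mN0] := mP N (ltnSn N).
have [] := IH (Q - cmx (coefmx Q N) *m P N).
- by move=> n nN; apply: mP; exact: ltnW.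
- move=> k; rewrite leq_eqVlt => /predU1P[<-|Nk].
    by rewrite coefmxD coefmxN coefmx_cmul mN1 mulmx1 subrr.
  by rewrite coefmxD coefmxN coefmx_cmul mN0// mulmx0 subr0 dQ.
move=> C eC; exists (fun m => if m == N then coefmx Q N else C m).
rewrite big_ord_recr /= eqxx -[LHS](subrK (cmx (coefmx Q N) *m P N)) eC.
congr (_ + _); apply: eq_bigr => m _; by rewrite ltn_eqF.
Qed.

End MatrixPolynomials.

(** * Orthogonal systems for a definite Hermitian matrix form; band operators versus bounded
    adjoints *)

Section OrthogonalPolynomials.
Variable R : realType.
Local Notation MP := 'M[{poly R[i]}]_2.
Variable B : MP -> MP -> 'M[R[i]]_2.
Hypothesis B_linear : forall A P P' Q,
  B (cmx A *m P + P') Q = A *m B P Q + B P' Q.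
Hypothesis B_hermitian : forall P Q, B Q P = adjmx (B P Q).
Hypothesis B_definite : forall P, B P P = 0 -> P = 0.

Let B0l Q : B 0 Q = 0.
Proof.
have := B_linear 1 0 0 Q; rewrite mulmx0 addr0 mul1mx => /eqP.
by rewrite -subr_eq0 opprD addrA subrr sub0r oppr_eq0 => /eqP.
Qed.

Let BZl A P Q : B (cmx A *m P) Q = A *m B P Q.
Proof. by have := B_linear A P 0 Q; rewrite addr0 B0l addr0. Qed.

Let BDl P P' Q : B (P + P') Q = B P Q + B P' Q.
Proof.
have := B_linear 1 P P' Q; rewrite mul1mx.
by rewrite (_ : cmx 1 = 1%:M) ?mul1mx// /cmx map_mx1.
Qed.

Let BZr A P Q : B P (cmx A *m Q) = B P Q *m adjmx A.
Proof. by rewrite B_hermitian BZl adjmxM -B_hermitian. Qed.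

Let B_suml N (F : 'I_N -> MP) Q : B (\sum_m F m) Q = \sum_m B (F m) Q.
Proof. exact: (big_morph (B^~ Q) (fun U V => BDl U V Q) (B0l Q)). Qed.

Let B_sumr N (F : 'I_N -> MP) Q : B Q (\sum_m F m) = \sum_m B Q (F m).
Proof.
rewrite B_hermitian B_suml (big_morph (@adjmx R) (@adjmxD R) (@adjmx0 R)).
by apply: eq_bigr => m _; rewrite -B_hermitian.
Qed.

(** If [K] is a left kernel matrix of the Gram matrix, then [K P] has zero norm, hence is 0 by
    definiteness, and [P] being monic gives [K = 0]. *)
Lemma gram_unit n P : monic_of_degree n P -> B P P \in unitmx.
Proof.
move=> mP; rewrite -row_free_unit -kermx_eq0; apply/eqP.
apply: (cmx_monic mP); apply: B_definite.
by rewrite BZl BZr mulmxA mulmx_ker mul0mx.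
Qed.

(** Gram-Schmidt applied to ['X^n], by strong induction. Gram matrices need not commute with other
    matrices, so they are inverted on the right. *)
Lemma monic_orthogonal_low_exists n : exists Pn, monic_of_degree n Pn /\
  forall Q, degree_lt n Q -> B Pn Q = 0.
Proof.
have [N] := ubnP n; elim: N n => // N IH n nN.
have /choice[P HP] : forall m, exists Pm, (m < n)%N -> monic_of_degree m Pm /\
    forall Q, degree_lt m Q -> B Pm Q = 0.
  move=> m; have [mn|_] := ltnP m n; last by exists 0.
  have [|Pm HPm] := IH m; last by exists Pm.
  by apply: leq_trans mn _; rewrite -ltnS.
have mP m : (m < n)%N -> monic_of_degree m (P m) by move=> /HP[].
have oP l m : (l < n)%N -> (m < n)%N -> l != m -> B (P l) (P m) = 0.
  move=> ln mn; rewrite neq_ltn => /orP[] lm; last first.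
    by apply: (HP l ln).2; apply: degree_ltW lm (monic_degree_lt (mP m mn)).
  rewrite B_hermitian (HP m mn).2 ?adjmx0//.
  exact: degree_ltW lm (monic_degree_lt (mP l ln)).
pose Xn : MP := ('X^n)%:M.
have cX k : coefmx Xn k = (k == n)%:R%:M.
  apply/matrixP => i j; rewrite !mxE; case: (i == j) => /=.
    by rewrite mulr1n coefXn; case: eqP.
  by rewrite mulr0n coef0 mulr0n.
(* Minus the coefficient of the projection of ['X^n] on [P m]. *)
pose c m := - (B Xn (P m) *m invmx (B (P m) (P m))).
exists (Xn + \sum_(m < n) cmx (c m) *m P m); split.
  have low : degree_lt n (\sum_(m < n) cmx (c m) *m P m).
    apply: degree_lt_sum => m k nk.
    rewrite coefmx_cmul (mP m (ltn_ord m)).2 ?mulmx0//.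
    exact: leq_trans nk.
  split=> [|k nk]; first by rewrite coefmxD low// cX eqxx addr0.
  rewrite coefmxD (low k (ltnW nk)) cX (gtn_eqF nk) addr0.
  by apply/matrixP => i j; rewrite !mxE mul0rn.
move=> Q dQ; have [C ->] := monic_expansion mP dQ.
rewrite B_sumr big1// => m _; rewrite BZr BDl B_suml.
rewrite (bigD1 m)//= big1 ?addr0; last first.
  by move=> l lm; rewrite BZl oP ?mulmx0.
by rewrite BZl /c mulNmx mulmxKV ?subrr ?mul0mx// (gram_unit (mP m _)).
Qed.

(** For [B] equal to [mxinner W] this is [monic_orthogonal W]. *)
Definition orthogonal_system (P : nat -> MP) :=
  (forall n, monic_of_degree n (P n)) /\ (forall m n, m <> n -> B (P m) (P n) = 0).

Lemma orthogonal_system_exists : exists P, orthogonal_system P.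
Proof.
have /choice[P HP] := monic_orthogonal_low_exists.
exists P; split=> [n|m n /eqP]; first by have [] := HP n.
rewrite neq_ltn => /orP[] mn; last first.
  by apply: (HP m).2; apply: degree_ltW mn (monic_degree_lt (HP n).1).
rewrite B_hermitian (HP n).2 ?adjmx0//.
exact: degree_ltW mn (monic_degree_lt (HP m).1).
Qed.

Variable P : nat -> MP.
Hypothesis P_orth : orthogonal_system P.

Let mP n : monic_of_degree n (P n). Proof. by have [] := P_orth. Qed.

Lemma orthogonal_low n Q : degree_lt n Q -> B (P n) Q = 0.
Proof.
move=> dQ; have [C ->] := monic_expansion (fun m _ => mP m) dQ.
rewrite B_sumr big1// => m _; rewrite BZr P_orth.2 ?mul0mx//.
by move=> nm; move: (ltn_ord m); rewrite -nm ltnn.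
Qed.

Lemma B_orthogonal_sum N (C : nat -> 'M[R[i]]_2) m : (m < N)%N ->
  B (\sum_(l < N) cmx (C l) *m P l) (P m) = C m *m B (P m) (P m).
Proof.
move=> mN; rewrite B_suml (bigD1 (Ordinal mN))//= big1 ?addr0 ?BZl//.
move=> l lm; rewrite BZl P_orth.2 ?mulmx0// => e.
by move: lm; rewrite -val_eqE /= e eqxx.
Qed.

(** Stands for the right action of a differential operator, which commutes with left multiplication
    by constant matrices. *)
Variable T : MP -> MP.
Hypothesis T_linear : forall A P P', T (cmx A *m P + P') = cmx A *m T P + T P'.

Let T0 : T 0 = 0.
Proof.
have := T_linear 1 0 0; rewrite mulmx0 addr0 (_ : cmx 1 = 1%:M) ?mul1mx;
  last by rewrite /cmx map_mx1.
by move/eqP; rewrite -subr_eq0 opprD addrA subrr sub0r oppr_eq0 => /eqP.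
Qed.

Let T_sum N (C : nat -> 'M[R[i]]_2) :
  T (\sum_(m < N) cmx (C m) *m P m) = \sum_(m < N) cmx (C m) *m T (P m).
Proof.
elim: N => [|N IH]; first by rewrite !big_ord0 T0.
by rewrite !big_ord_recr /= addrC T_linear IH addrC.
Qed.

(** [T (P n)] involves no [P m] with [m < n - discop_lo M], so its pairing with a fixed [Q] vanishes
    for large [n]. Finitely many pairings then prescribe the adjoint [Q'] as a finite combination of
    the [P m]. *)
Lemma discop_adjoint (M : discop R) : (forall n, T (P n) = discop_act M P n) ->
  forall Q, exists Q', forall S, B (T S) Q = B S Q'.
Proof.
move=> TM Q; have [d dQ] := degree_lt_exists Q.
pose N := (d + discop_lo M)%N.
have hi n : (N <= n)%N -> B (T (P n)) Q = 0.
  move=> Nn; rewrite TM /discop_act.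
  pose F i := map_mx polyC (discop_coef M (i%:Z - (discop_lo M)%:Z) n)
    *m extend0 P (n%:Z + (i%:Z - (discop_lo M)%:Z)).
  rewrite B_suml big1// => i _; rewrite /F BZl.
  have -> : (n%:Z + (i%:Z - (discop_lo M)%:Z)) = (n + i - discop_lo M)%N by lia.
  rewrite /= orthogonal_low ?mulmx0//; apply: (degree_ltW _ dQ); lia.
pose H m := B (P m) (P m).
(* Solves [H m *m adjmx (c m) = B (T (P m)) Q], the pairing of [P m] with [Q'] being the left
   side. *)
pose c m := adjmx (invmx (H m) *m B (T (P m)) Q).
pose Q' := \sum_(m < N) cmx (c m) *m P m.
exists Q' => S.
have low m : B (P m) Q' = B (T (P m)) Q.
  have [mN|Nm] := ltnP m N.
    rewrite B_hermitian (B_orthogonal_sum c)// adjmxM adjmxK -B_hermitian.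
    rewrite mulmxA mulmxV ?mul1mx//.
    exact: gram_unit (mP m).
  rewrite hi// orthogonal_low//; apply: degree_ltW Nm _.
  apply: degree_lt_sum => l k nk.
  by rewrite coefmx_cmul (mP l).2 ?mulmx0//; exact: leq_trans nk.
have [e dS] := degree_lt_exists S.
have [C ->] := monic_expansion (fun m _ => mP m) dS.
rewrite T_sum !B_suml.
by apply: eq_bigr => m _; rewrite !BZl low.
Qed.

(** Degree growth [k] of [T] bounds the band above. Below, the coefficient of [T (P n)] on [P m] is
    read off from the pairing of [P n] with the adjoint of [P m], which is 0 when [m + l < n]. *)
Lemma adjoint_discop (k l : nat) :
  (forall N S, degree_lt N S -> degree_lt (N + k) (T S)) ->
  (forall N Q, degree_lt N Q -> exists2 Q', degree_lt (N + l) Q' &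
     forall S, B (T S) Q = B S Q') ->
  exists M : discop R, forall n, T (P n) = discop_act M P n.
Proof.
move=> Tk adjT.
have /choice[C HC] n : exists C : nat -> 'M[R[i]]_2,
    T (P n) = \sum_(m < n.+1 + k) cmx (C m) *m P m.
  by apply: monic_expansion => [m _|]; [exact: mP|apply/Tk/monic_degree_lt/mP].
have C0 n m : (m < n.+1 + k)%N -> (m + l < n)%N -> C n m = 0.
  move=> mk mln; have [Q' dQ' eQ'] := adjT _ _ (monic_degree_lt (mP m)).
  have := eQ' (P n); rewrite HC B_orthogonal_sum//.
  rewrite [RHS]orthogonal_low; last by apply: (degree_ltW _ dQ'); lia.
  move/(congr1 (mulmx^~ (invmx (B (P m) (P m))))).
  by rewrite mulmxK ?mul0mx// (gram_unit (mP m)).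
(* At a negative index [n + j] the value 0 is harmless, since [extend0] vanishes there. *)
exists (Discop l k (fun j n => if n%:Z + j is Posz m then C n m else 0)) => n.
rewrite HC /discop_act /=.
pose f m := cmx (C n m) *m P m.
(* The index [s] stands for [m + l], which keeps possibly negative [m] within the naturals. Dropping
   the zero terms below [l] leaves the expansion of [T (P n)]; dropping those below [n] leaves the
   band sum. *)
pose h s := if (l <= s)%N then f (s - l)%N else 0.
have low N : (N <= l)%N \/ (N <= n)%N -> \sum_(0 <= s < N) h s = 0.
  move=> HN; rewrite big_nat big1// => s sN; rewrite /h; case: leqP => // ls.
  by rewrite /f C0 ?/cmx ?map_mx0 ?mul0mx//; lia.
transitivity (\sum_(0 <= s < n + (l + k).+1) h s).
  rewrite (@big_cat_nat _ _ _ l)//=; last by lia.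
  rewrite low ?add0r; last by left.
  rewrite -{1}[l]add0n big_addn.
  rewrite (_ : n + (l + k).+1 - l = n.+1 + k)%N; last by lia.
  by rewrite big_mkord; apply: eq_bigr => m _; rewrite /h leq_addl addnK.
rewrite (@big_cat_nat _ _ _ n)//=; last by lia.
rewrite low ?add0r; last by right.
rewrite -{1}[n]add0n big_addn addKn big_mkord.
apply: eq_bigr => i _; rewrite /h.
case: leqP => li.
  have -> : (n%:Z + (i%:Z - l%:Z)) = Posz (i + n - l)%N by lia.
  by [].
have [m ->] : exists m, (n%:Z + (i%:Z - l%:Z)) = Negz m.
  exists (l - (i + n)).-1; lia.
by rewrite map_mx0 mul0mx.
Qed.

End OrthogonalPolynomials.

(** * The inner product of the weight in diagonalizing coordinates *)

Section WeightInnerProduct.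
Variables (R : realType) (a b : R).
Local Notation MP := 'M[{poly R[i]}]_2.
Implicit Types (P Q S : MP) (A : 'M[R[i]]_2).

(* The second entry of row [i] of [P *m T], where [T = [[1, a x], [0, 1]]]
   diagonalizes the weight: [W = T diag(wt b, wt 0) T^*]. *)
Definition twist P (i : 'I_2) : {poly R[i]} := a%:C *: ('X * P i 0) + P i 1.

(** From [W = T diag(wt b, wt 0) T^*]: the columns of [P T] are the first column of [P] and
    [twist P]. *)
Lemma mxinner_weightE P Q : mxinner (weight a b) P Q = \matrix_(i, j)
  (cgint b (P i 0 * pconj (Q j 0)) + cgint 0 (twist P i * pconj (twist Q j))).
Proof.
apply/matrixP => i j.
rewrite [RHS]mxE mxE -cintegral_poly_wt; congr cintegral; apply/funext => x.
have hconj (p : {poly R[i]}) : (pconj p).[x%:C] = conjc p.[x%:C].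
  by rewrite -[X in (pconj p).[X]]conjc_real horner_map.
rewrite !hornerM !hconj /twist !(hornerD, hornerZ, hornerM, hornerX).
have -> : wt b x = expR (- x ^+ 2) * expR (2 * b * x) by rewrite /wt expRD.
have -> : wt 0 x = expR (- x ^+ 2) by rewrite /wt mulr0 mul0r addr0.
rewrite !mxE !big_ord_recl !big_ord0 !mxE !big_ord_recl !big_ord0 !mxE /=.
rewrite (_ : lift ord0 ord0 = 1); last exact/val_inj.
have realD (u v : R) : (u + v)%:C = u%:C + v%:C by rewrite rmorphD.
have realM (u v : R) : (u * v)%:C = u%:C * v%:C by rewrite rmorphM.
have conjD (u v : R[i]) : conjc (u + v) = conjc u + conjc v by rewrite rmorphD.
have conjM (u v : R[i]) : conjc (u * v) = conjc u * conjc v by rewrite rmorphM.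
rewrite !(conjD, conjM) !conjc_real !expr2 !(realD, realM).
ring.
Qed.

Let lift1 : lift ord0 ord0 = 1 :> 'I_2. Proof. exact/val_inj. Qed.

Lemma cmx_mul_entry A P P' i j :
  (cmx A *m P + P') i j = A i 0 *: P 0 j + A i 1 *: P 1 j + P' i j.
Proof.
by rewrite !mxE !big_ord_recl !big_ord0 !mxE lift1 addr0 !mul_polyC.
Qed.

Lemma twist_linear A P P' i :
  twist (cmx A *m P + P') i = A i 0 *: twist P 0 + A i 1 *: twist P 1 + twist P' i.
Proof. by rewrite /twist !cmx_mul_entry -!mul_polyC; ring. Qed.

Lemma weight_inner_linear A P P' Q : mxinner (weight a b) (cmx A *m P + P') Q =
  A *m mxinner (weight a b) P Q + mxinner (weight a b) P' Q.
Proof.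
rewrite !mxinner_weightE; apply/matrixP => i j.
rewrite mxE twist_linear cmx_mul_entry [RHS]mxE [X in _ = X + _]mxE.
rewrite !big_ord_recl big_ord0 lift1 addr0 !mxE.
rewrite 4!mulrDl.
rewrite -4!scalerAl.
rewrite 4!cgintD.
rewrite 4!cgintZ.
move: (cgint b (P 0 0 * _)) (cgint b (P 1 0 * _)) (cgint b (P' i 0 * _)).
move: (cgint 0 (twist P 0 * _)) (cgint 0 (twist P 1 * _)) (cgint 0 (twist P' i * _)).
move=> ? ? ? ? ? ?; ring.
Qed.

Lemma weight_inner_hermitian P Q :
  mxinner (weight a b) Q P = adjmx (mxinner (weight a b) P Q).
Proof.
rewrite !mxinner_weightE; apply/matrixP => i j; rewrite !mxE.
have conjD (u v : R[i]) : conjc (u + v) = conjc u + conjc v by rewrite rmorphD.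
rewrite conjD -!cgint_conj /pconj !rmorphM /= -!/(pconj _) !pconjK.
by congr (cgint _ _ + cgint _ _); rewrite mulrC.
Qed.

(** Each diagonal entry is a sum of two nonnegative squared norms, so both coordinates of each row
    vanish. *)
Lemma weight_inner_definite P : mxinner (weight a b) P P = 0 -> P = 0.
Proof.
rewrite mxinner_weightE => /matrixP H.
have row i : P i 0 = 0 /\ twist P i = 0.
  have := H i i; rewrite !mxE => /eqP.
  rewrite paddr_eq0 ?cgint_sqr_ge0// => /andP[/eqP e0 /eqP e1].
  by split; [exact: cgint_sqr_eq0 e0|exact: cgint_sqr_eq0 e1].
apply/matrixP => i j; rewrite mxE; have [e0 e1] := row i.
have [->|j0] := eqVneq j 0; first exact: e0.
have -> : j = 1 by apply/val_inj; case: j j0 => [[|[|?]]].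
by move: e1; rewrite /twist e0 mulr0 scaler0 add0r.
Qed.

End WeightInnerProduct.

(** * Adjoints of scalar differential operators for one and for two Gaussian weights *)

Section ScalarOperators.
Variable R : realType.
Implicit Types (c d : R) (p q r s : {poly R[i]}).

(** The transpose of differentiation for [cgint c]: the raising operator of the Hermite polynomials
    centred at [c]. *)
Definition raise c s : {poly R[i]} := 2 *: ('X - c%:C%:P) * s - s^`().

Lemma cgint_derivn_adjoint c j r s :
  cgint c (r^`(j) * s) = cgint c (r * iter j (raise c) s).
Proof.
elim: j r s => [|j IH] r s //; rewrite derivnS iterSr -IH.
apply/eqP; rewrite -subr_eq0; apply/eqP.
have := cgint_deriv c (r^`(j) * s); rewrite derivM cgintD => e.
rewrite /raise mulrBr raddfB /= mulrCA -e; ring.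
Qed.

Lemma size_raise c s : (size (raise c s) <= (size s).+1)%N.
Proof.
apply: leq_trans (size_polyD _ _) _; rewrite size_polyN geq_max; apply/andP; split.
  rewrite -scalerAl; apply: leq_trans (size_scale_leq _ _) _.
  apply: leq_trans (size_polyMleq _ _) _; by rewrite size_XsubC.
apply: leqW.
have [->|s0] := eqVneq s 0; first by rewrite deriv0.
exact: ltnW (lt_size_deriv s0).
Qed.

Lemma size_iter_raise c j s : (size (iter j (raise c) s) <= size s + j)%N.
Proof.
elim: j => [|j IH]; first by rewrite addn0.
by rewrite iterS addnS; apply: leq_trans (size_raise _ _) _.
Qed.

Lemma size_pconj s : size (pconj s) = size s.
Proof. exact: size_map_poly. Qed.

(** Repeated integration by parts. The degree increase [l] is uniform in [s], which later bounds the
    band from below. *)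
Lemma scalar_adjoint c N (e : nat -> {poly R[i]}) :
  exists l, forall s, exists2 s' : {poly R[i]},
  (size s' <= size s + l)%N &
  forall r, cgint c ((\sum_(j < N) r^`(j) * e j) * pconj s) = cgint c (r * pconj s').
Proof.
exists (\sum_(j < N) (size (e j) + j))%N => s.
exists (pconj (\sum_(j < N) iter j (raise c) (e j * pconj s))).
  rewrite size_pconj; apply: leq_trans (size_sum _ _ _) _; apply/bigmax_leqP => j _.
  apply: leq_trans (size_iter_raise _ _ _) _.
  rewrite (bigD1 j)//=; have := size_polyMleq (e j) (pconj s); rewrite size_pconj.
  move: (size (e j * _)) (size (e j)) (size s) => u v w; lia.
move=> r; rewrite pconjK mulr_suml mulr_sumr !raddf_sum /=.
by apply: eq_bigr => j _; rewrite -mulrA cgint_derivn_adjoint.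
Qed.

(** Applied to ['X^j], once the coefficients below [j] are known to vanish, the operator gives [j!]
    times [e j]. *)
Lemma diffop_coef_eq0 N (e : nat -> {poly R[i]}) :
  (forall r, \sum_(j < N) r^`(j) * e j = 0) -> forall j, (j < N)%N -> e j = 0.
Proof.
move=> H; elim/ltn_ind => j IH jN.
have := H 'X^j; rewrite (bigD1 (Ordinal jN))//= big1 ?addr0; last first.
  move=> i; rewrite -val_eqE /= neq_ltn => /orP[] ij.
    by rewrite IH ?mulr0.
  by rewrite derivnXn ffact_small// mulr0n mul0r.
rewrite derivnXn subnn ffactnn expr0 mulr_natl => /polyP E.
apply/polyP => i; have /eqP := E i; rewrite coefMn coef0 mulrn_eq0.
by rewrite -leqn0 leqNgt fact_gt0 => /eqP.
Qed.

(** The operator also has an adjoint within weight [c]. Comparing the two adjoints of [s],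
    independence of the weights forces both to be 0; taking for [s] the image of [r] shows that this
    image has zero norm. *)
Lemma cross_adjoint_eq0 c d N (e : nat -> {poly R[i]}) : c != d ->
  (forall s, exists t, forall r,
     cgint c ((\sum_(j < N) r^`(j) * e j) * pconj s) = cgint d (r * t)) ->
  forall j, (j < N)%N -> e j = 0.
Proof.
move=> cd H; apply: diffop_coef_eq0 => r; apply: (@cgint_sqr_eq0 _ c).
set s := \sum_(j < N) _.
have [l /(_ s)[s' _ Hs']] := scalar_adjoint c N e.
have [t Ht] := H s.
rewrite {1}/s Hs' (_ : pconj s' = 0) ?mulr0 ?raddf0//.
rewrite eq_sym in cd; apply: (cgint_indep cd (al := - t)) => q.
by rewrite mulrN raddfN /= -Ht -Hs' addNr.
Qed.

Lemma derivnXM r j : (('X * r)^`(j) = 'X * r^`(j) + r^`(j.-1) *+ j)%R.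
Proof.
elim: j => [|j IH]; first by rewrite !derivn0 mulr0n addr0.
rewrite derivnS IH derivD derivM derivX mul1r derivMn -!derivnS /=.
case: j {IH} => [|j]; first by rewrite mulr0n addr0 derivn0 addrC.
by rewrite [in RHS](mulrS _ j.+1) addrA [X in X + _ = _]addrC.
Qed.

End ScalarOperators.

(** * Linearity and degree growth of the action of matrix differential operators *)

Section DiffopAction.
Variable R : realType.
Local Notation MP := 'M[{poly R[i]}]_2.
Implicit Types (P Q S : MP) (D : diffop R).

Lemma diffop_act_widen P D N : (size D <= N)%N ->
  diffop_act P D = \sum_(j < N) derivnmx j P *m D`_j.
Proof.
move=> DN; rewrite /diffop_act.
rewrite (big_ord_widen N (fun j => derivnmx j P *m D`_j) DN) big_mkcond /=.
apply: eq_bigr => j _; case: ltnP => // Dj.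
by rewrite nth_default// mulmx0.
Qed.

Lemma derivnmx_linear A P P' j :
  derivnmx j (cmx A *m P + P') = cmx A *m derivnmx j P + derivnmx j P'.
Proof.
apply/matrixP => i l.
by rewrite [RHS]cmx_mul_entry mxE cmx_mul_entry !mxE !derivnD !derivnZ.
Qed.

Lemma diffop_act_linear D A P P' :
  diffop_act (cmx A *m P + P') D = cmx A *m diffop_act P D + diffop_act P' D.
Proof.
rewrite /diffop_act mulmx_sumr -big_split; apply: eq_bigr => j _ /=.
by rewrite derivnmx_linear mulmxDl mulmxA.
Qed.

Lemma diffop_actD P D D' : diffop_act P (D + D') = diffop_act P D + diffop_act P D'.
Proof.
pose N := maxn (size D) (size D').
rewrite !(@diffop_act_widen _ _ N) ?leq_maxl ?leq_maxr ?size_polyD//.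
by rewrite -big_split; apply: eq_bigr => j _; rewrite coefD mulmxDr.
Qed.

Lemma diffop_act_sum P N (D : 'I_N -> diffop R) :
  diffop_act P (\sum_j D j) = \sum_j diffop_act P (D j).
Proof.
apply: (big_morph (diffop_act P) (@diffop_actD P)).
by rewrite /diffop_act size_poly0 big_ord0.
Qed.

Lemma diffop_act_term P j F : diffop_act P (diffterm j F) = derivnmx j P *m F.
Proof.
rewrite (@diffop_act_widen _ _ j.+1); last first.
  by apply: leq_trans (size_scale_leq _ _) _; rewrite size_polyXn.
rewrite big_ord_recr big1 /= ?add0r.
  by rewrite coefZ coefXn eqxx mulr1.
by move=> l _; rewrite coefZ coefXn ltn_eqF// mulr0 mulmx0.
Qed.

Lemma ord2_sum (V : nmodType) (F : 'I_2 -> V) : \sum_i F i = F 0 + F 1.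
Proof.
rewrite !big_ord_recl big_ord0 addr0; congr (_ + F _); exact/val_inj.
Qed.

Lemma derivnmx_mul_entry j P (F : MP) i l : (derivnmx j P *m F) i l =
  (P i 0)^`(j) * F 0 l + (P i 1)^`(j) * F 1 l.
Proof. by rewrite mxE ord2_sum !mxE. Qed.

Lemma size_derivn_le j (p : {poly R[i]}) : (size (p^`(j))%R <= size p)%N.
Proof.
elim: j => // j IH; rewrite derivnS; apply: leq_trans IH.
have [->|p0] := eqVneq (p^`(j))%R 0; first by rewrite deriv0.
exact: ltnW (lt_size_deriv p0).
Qed.

Lemma diffop_act_degree D : exists k, forall N S, degree_lt N S ->
  degree_lt (N + k) (diffop_act S D).
Proof.
have /choice[k Hk] j := degree_lt_exists D`_j.
exists (\sum_(j < size D) k j)%N => N S /degree_ltP dS.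
apply: degree_lt_sum => j; apply/degree_ltP => i l.
have /degree_ltP Hkj := Hk j.
have bound (u v : {poly R[i]}) : (size u <= N)%N -> (size v <= k j)%N ->
    (size (u * v)%R <= N + k j)%N.
  by move=> uN vk; have := size_polyMleq u v; lia.
rewrite derivnmx_mul_entry; apply: leq_trans (_ : N + k j <= _)%N.
  apply: leq_trans (size_polyD _ _) _; rewrite geq_max.
  by rewrite !bound// (leq_trans (size_derivn_le _ _)).
by rewrite leq_add2l (bigD1 j)//= leq_addr.
Qed.

End DiffopAction.

(** * The operators of the theorem: their adjoints, and the converse *)

Section FourierAlgebra.
Variables (R : realType) (a b : R).
Local Notation MP := 'M[{poly R[i]}]_2.
Local Notation B := (mxinner (weight a b)).

(** This is [T diag(E_1, E_2) T^-1], where [E_1] and [E_2] have coefficients [p] and [q]. At [j = 0]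
    the truncated [j.-1] does no harm, its coefficient being 0. *)
Definition fourier_operator n (p q : nat -> {poly R[i]}) : diffop R :=
  \sum_(j < n.+1)
    (diffterm j (mat2 (p j) (a%:C *: ('X * (q j - p j)))
                      0     (q j))
     + diffterm j.-1 (mat2 0 ((j%:R * a%:C) *: q j)
                           0 0)).

Lemma fourier_operator_act0 n p q P i :
  (diffop_act P (fourier_operator n p q)) i 0 = \sum_(j < n.+1) (P i 0)^`(j) * p j.
Proof.
rewrite diffop_act_sum summxE; apply: eq_bigr => j _.
rewrite diffop_actD !diffop_act_term mxE !derivnmx_mul_entry !mxE /=.
by rewrite !mulr0 !addr0.
Qed.

Lemma derivn_twist P i j : ((twist a P i)^`(j) =
  a%:C *: ('X * (P i 0)^`(j) + (P i 0)^`(j.-1) *+ j) + (P i 1)^`(j))%R.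
Proof. by rewrite /twist derivnD derivnZ derivnXM. Qed.

(** The Leibniz term from differentiating ['X * P i 0] is exactly what the second summand of each
    term supplies, so the twisted coordinate sees only [q]. *)
Lemma fourier_operator_twist n p q P i :
  twist a (diffop_act P (fourier_operator n p q)) i =
  \sum_(j < n.+1) (twist a P i)^`(j) * q j.
Proof.
rewrite {1}/twist fourier_operator_act0 diffop_act_sum summxE.
rewrite mulr_sumr scaler_sumr -big_split; apply: eq_bigr => j _ /=.
rewrite diffop_actD !diffop_act_term mxE !derivnmx_mul_entry !mxE /=.
rewrite derivn_twist -!mul_polyC polyCM polyC_natr -mulr_natr; ring.
Qed.

Lemma size_twist N P i : degree_lt N P -> (size (twist a P i) <= N.+1)%N.
Proof.
move/degree_ltP => dP; apply: leq_trans (size_polyD _ _) _.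
rewrite geq_max (leqW (dP i 1)) andbT; apply: leq_trans (size_scale_leq _ _) _.
by apply: leq_trans (size_polyMleq _ _) _; rewrite size_polyX add2n ltnS.
Qed.

(** Right multiplication by [T^-1]: the matrix with first column [u] and twisted coordinate [v]. *)
Definition untwist (u v : 'I_2 -> {poly R[i]}) : MP :=
  \matrix_(i, j) if j == 0 then u i else v i - a%:C *: ('X * u i).

Lemma untwist0 u v i : untwist u v i 0 = u i.
Proof. by rewrite mxE. Qed.

Lemma twist_untwist u v i : twist a (untwist u v) i = v i.
Proof. by rewrite /twist !mxE /= addrC subrK. Qed.

(** The operator is diagonal in twisted coordinates, so scalar adjoints for [wt b] and [wt 0]
    combine. The extra [2] covers the factors ['X] in [twist] and [untwist]. *)
Lemma fourier_operator_adjoint n p q : exists l, forall N Q, degree_lt N Q ->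
  exists2 Q', degree_lt (N + l) Q' &
    forall S, B (diffop_act S (fourier_operator n p q)) Q = B S Q'.
Proof.
have [l1 H1] := scalar_adjoint b n.+1 p.
have [l2 H2] := scalar_adjoint 0 n.+1 q.
exists (l1 + l2 + 2)%N => N Q dQ.
have /choice[u Hu] i : exists s' : {poly R[i]}, (size s' <= size (Q i 0%R) + l1)%N /\
  forall r, cgint b ((\sum_(j < n.+1) r^`(j) * p j) * pconj (Q i 0)) =
            cgint b (r * pconj s').
  by have [s'] := H1 (Q i 0); exists s'.
have /choice[v Hv] i : exists s' : {poly R[i]}, (size s' <= size (twist a Q i) + l2)%N /\
  forall r, cgint 0 ((\sum_(j < n.+1) r^`(j) * q j) * pconj (twist a Q i)) =
            cgint 0 (r * pconj s').
  by have [s'] := H2 (twist a Q i); exists s'.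
exists (untwist u v).
  apply/degree_ltP => i j; rewrite mxE.
  have su : (size (u i) <= N + l1)%N.
    by rewrite (leq_trans (Hu i).1)// leq_add2r; move/degree_ltP: dQ; apply.
  have sv : (size (v i) <= N.+1 + l2)%N.
    by rewrite (leq_trans (Hv i).1)// leq_add2r size_twist.
  case: ifP => _; first by lia.
  apply: leq_trans (size_polyD _ _) _; rewrite size_polyN geq_max; apply/andP.
  split; first by lia.
  apply: leq_trans (size_scale_leq _ _) _.
  by apply: leq_trans (size_polyMleq _ _) _; rewrite size_polyX add2n /=;
    move: su; move: (size (u i)) => z; lia.
move=> S; rewrite !mxinner_weightE; apply/matrixP => i j.
rewrite [LHS]mxE [RHS]mxE fourier_operator_act0 fourier_operator_twist (Hu j).2 (Hv j).2.
by rewrite untwist0 twist_untwist.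
Qed.

(** Test matrices supported in one coordinate isolate the off-diagonal entries of [T^-1 D T]. Each
    of them pairs one weight with the other, hence vanishes since [b != 0]; the diagonal entries
    provide [p] and [q]. *)
Lemma adjoint_fourier_operator D : b != 0 ->
  (forall Q, exists Q', forall S, B (diffop_act S D) Q = B S Q') ->
  exists n p q, D = fourier_operator n p q.
Proof.
move=> b_neq0 adjD; pose N := size D.
pose f j := D`_j 0 0; pose g j := D`_j 0 1; pose h j := D`_j 1 0; pose k j := D`_j 1 1.
have pc0 : pconj 0 = 0 :> {poly R[i]} by rewrite /pconj map_poly0.
have out j : (N <= j)%N -> D`_j = 0 by exact: nth_default.
have h0 j : h j = 0.
  have [Nj|jN] := leqP N j; first by rewrite /h out// mxE.
  apply: (cross_adjoint_eq0 b_neq0 (N := N)) jN => s.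
  have [Q' HQ'] := adjD (untwist (fun=> s) (fun=> 0)).
  exists (pconj (twist a Q' 0)) => r.
  have := HQ' (untwist (fun=> 0) (fun=> r)).
  rewrite !mxinner_weightE => /matrixP/(_ 0 0).
  rewrite [LHS]mxE [RHS]mxE !twist_untwist !untwist0 mul0r raddf0 add0r => <-.
  rewrite pc0 mulr0 raddf0 addr0.
  apply: (congr1 (fun t => cgint b (t * pconj s))).
  rewrite summxE; apply: eq_bigr => j' _.
  by rewrite derivnmx_mul_entry !mxE /= mulr0 scaler0 subr0 linear0 mul0r add0r.
(* The coefficients of the upper right entry of [T^-1 D T]; the [k j.+1] term comes from
   differentiating ['X * r]. *)
pose e j := a%:C *: ('X * f j) + g j - a%:C *: ('X * k j) - a%:C *: (k j.+1 *+ j.+1).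
have e0 j : e j = 0.
  have [Nj|jN] := leqP N j.
    by rewrite /e /f /g /k !out ?(leqW Nj)// !mxE mulr0 mul0rn !scaler0 !subr0 addr0.
  have b0 : 0 != b by rewrite eq_sym.
  apply: (cross_adjoint_eq0 b0 (N := N)) jN => s.
  have [Q' HQ'] := adjD (untwist (fun=> 0) (fun=> s)).
  exists (pconj (Q' 0 0)) => r.
  have := HQ' (untwist (fun=> r) (fun=> 0)).
  rewrite !mxinner_weightE => /matrixP/(_ 0 0).
  rewrite [LHS]mxE [RHS]mxE !twist_untwist !untwist0 mul0r raddf0 addr0 => <-.
  rewrite pc0 mulr0 raddf0 add0r.
  symmetry; apply: (congr1 (fun t => cgint 0 (t * pconj s))).
  pose u j := (r^`(j.-1) * k j) *+ j.
  (* Collects by order of derivative: the term of index 0 carries the factor 0, and [k N] is 0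
     beyond the size of [D]. *)
  have shift : \sum_(j < N) u j = \sum_(j < N) (r^`(j) * k j.+1) *+ j.+1.
    have uN : u N = 0 by rewrite /u /k out// mxE mulr0 mul0rn.
    have E : \sum_(j < N.+1) u j = \sum_(j < N) u j by rewrite big_ord_recr /= uN addr0.
    by rewrite -E big_ord_recl /u mulr0n add0r.
  transitivity (\sum_(j < N) r^`(j) * (a%:C *: ('X * f j) + g j - a%:C *: ('X * k j))
                - a%:C *: \sum_(j < N) u j).
    rewrite /twist /diffop_act -/N !summxE mulr_sumr !scaler_sumr -sumrN -!big_split.
    apply: eq_bigr => j' _ /=; rewrite !derivnmx_mul_entry !untwist0.
    rewrite -/(f j') -/(g j') -/(h j') -/(k j') h0 mxE /= sub0r.
    rewrite derivnN derivnZ derivnXM /u.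
    move: (f j') (g j') (k j') (r^`(j'))%R (r^`(j'.-1))%R => F G K r0 r1.
    rewrite -!mul_polyC.
    ring.
  rewrite shift scaler_sumr -sumrN -big_split; apply: eq_bigr => j' _ /=.
  rewrite /e; move: (f j') (g j') (k j') (k j'.+1) (r^`(j'))%R => F G K K' r0.
  rewrite -!mul_polyC; ring.
(* Taking [N] instead of its predecessor also covers [D = 0]; the additional top term is 0. *)
exists N, f, k.
have -> : D = \sum_(j < N) diffterm j D`_j by rewrite -[LHS]coefK poly_def.
have mat20 : mat2 0 0 0 0 = 0 :> MP.
  by apply/matrixP => i j; rewrite !mxE; do !case: ifP.
(* The first sum loses its zero top term and the second its zero bottom term, which aligns both by
   order of derivative. *)
rewrite /fourier_operator big_split /= [in X in _ + X]big_ord_recl.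
rewrite big_ord_recr /= mul0r scale0r mat20.
have -> : f N = 0 by rewrite /f out// mxE.
have -> : k N = 0 by rewrite /k out// mxE.
rewrite subr0 mulr0 scaler0 mat20 /diffterm !scale0r addr0 add0r -big_split /=.
apply: eq_bigr => j _; rewrite /bump /= add1n /= -scalerDl; congr (_ *: _).
have g_eq : g j = a%:C *: ('X * (k j - f j)) + (j.+1%:R * a%:C) *: k j.+1.
  apply/eqP; rewrite -subr_eq0 -(e0 j) /e; apply/eqP.
  move: (f j) (g j) (k j) (k j.+1) => F G K K'.
  rewrite -!mul_polyC polyCM polyC_natr; ring.
apply/matrixP => i l; rewrite !mxE.
case: i l => [[|[|//]] Hi] [[|[|//]] Hl] /=; rewrite ?addr0.
- by congr (D`_j _ _); exact/val_inj.
- by rewrite -g_eq; congr (D`_j _ _); exact/val_inj.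
- by rewrite -(h0 j); congr (D`_j _ _); exact/val_inj.
- by congr (D`_j _ _); exact/val_inj.
Qed.

End FourierAlgebra.

Theorem theorem4p3 (R : realType) (a b : R) (ha : a != 0) (hb : b != 0) :
  right_fourier_algebra (weight a b) =
  [set D : diffop R | exists (n : nat) (p q : nat -> {poly R[i]}),
     D = \sum_(j < n.+1)
           (diffterm j (mat2 (p j) (a%:C *: ('X * (q j - p j)))
                             0     (q j))
            + diffterm j.-1 (mat2 0 ((j%:R * a%:C) *: q j)
                                  0 0))].
Proof.
apply/seteqP; split=> [D [P [HP [M HM]]]|_ [n [p [q ->]]]].
  apply: (@adjoint_fourier_operator _ a b D hb).
  exact: (discop_adjoint (@weight_inner_linear R a b)
    (@weight_inner_hermitian R a b) (@weight_inner_definite R a b) HP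
    (@diffop_act_linear R D) HM).
(* For the reverse inclusion an orthogonal system has to be produced; the degree bounds [k] and [l]
   of the operator and its adjoint then give the band. *)
have [P HP] := orthogonal_system_exists (@weight_inner_linear R a b)
  (@weight_inner_hermitian R a b) (@weight_inner_definite R a b).
exists P; split => //.
have [k Hk] := diffop_act_degree (fourier_operator a n p q).
have [l Hl] := fourier_operator_adjoint a b n p q.
exact: (adjoint_discop (@weight_inner_linear R a b)
  (@weight_inner_hermitian R a b) (@weight_inner_definite R a b) HP Hk Hl).
Qed.
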